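(* Let $r\ge 2$ be an integer, let $G\in\mathcal{M}_{1/r}(\mathcal{C})$ be such that $r$ does not divide $v(G)$, and let $G^+$ denote a graph obtained by subdividing an arbitrary edge of $G$ (i.e. replacing an edge $xy$ by a path $xzy$ with $z$ a new vertex). Then $G^+\in\mathcal{M}_{1/r}(\mathcal{C})$.
   Context: All graphs are finite and simple; $v(G)$ denotes the number of vertices of $G$. For an integer $r\ge2$, $\mathcal{R}_{1/r}(\mathcal{C})$ denotes the class of graphs $G$ such that every colouring of $E(G)$ with $r+1$ colours admits a cycle in $G$ (of arbitrary length) whose edges use at most $r$ of the colours. $\mathcal{M}_{1/r}(\mathcal{C})$ is the class of those $G\in\mathcal{R}_{1/r}(\mathcal{C})$ that are minimal with respect to the subgraph relation, i.e. no proper subgraph of $G$ belongs to $\mathcal{R}_{1/r}(\mathcal{C})$. *)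

(* Defs.v *)
From mathcomp Require Import all_boot.

Set Implicit Arguments.
Unset Strict Implicit.
Unset Printing Implicit Defensive.

(* A finite simple graph is a pair (V, E) of sets inside an ambient finite
   universe T, so that subgraphs, and subdivisions using a new vertex
   z \notin V, all live over the same T. *)
Record sgraph (T : finType) := SGraph {
  vset : {set T};
  eset : {set {set T}};
  _ : [forall f in eset, (f \subset vset) && (#|f| == 2)] }.

Section Graphs.

Variable T : finType.
Implicit Types (G H : sgraph T) (s : seq T).

Definition order_graph G : nat := #|vset G|.

Definition adj G : rel T := [rel x y | [set x; y] \in eset G].

Definition subgraph H G : bool :=
  (vset H \subset vset G) && (eset H \subset eset G).

(* The validity field of sgraph is boolean, hence proof-irrelevant: H <> G
   says that the vertex sets or the edge sets differ. *)
Definition proper_subgraph H G : Prop := subgraph H G /\ H <> G.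

Definition is_cycle G s : Prop := 2 < size s /\ ucycle (adj G) s.

Definition cycle_edges s : {set {set T}} := [set [set x; next s x] | x in s].

(* Colourings are total on {set T}; only their values on eset G matter. *)
Definition ramsey_cycle (r : nat) G : Prop :=
  forall c : {set T} -> 'I_r.+1,
    exists s, is_cycle G s /\ #|c @: cycle_edges s| <= r.

Definition minimal_ramsey_cycle (r : nat) G : Prop :=
  ramsey_cycle r G /\
  forall H, proper_subgraph H G -> ~ ramsey_cycle r H.

Definition edge_subdivision G Gp : Prop :=
  exists x y z : T,
    [/\ [set x; y] \in eset G,
        z \notin vset G,
        vset Gp = z |: vset G &
        eset Gp = (eset G :\ [set x; y]) :|: [set [set x; z]; [set z; y]]].

End Graphs.

(* Main.v *)
Require Import Defs.
From mathcomp Require Import all_boot.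

(* A graph is not in R_{1/r}(C) iff its edges have a colouring with r + 1 colours
   such that, for every colour i, the edges of colour other than i form a forest
   F_i.  Suppose the subdivision of xy has such a colouring.  On G it yields r + 1
   forests such that every edge misses exactly one of them, except xy, which
   misses two (if it missed only one, G would be colourable).  Moving the defect
   along fundamental cycles (replace F_i by F_i + e - f) preserves the span of
   each F_i on the set S of all edges the defect can reach, and shows that S is
   spanned by each F_i restricted to S.  Hence r |S| - 1 = (r + 1) rank(S), so S is
   not colourable, and S = E(G) by minimality.  As G is connected,
   rank(S) = v(G) - 1, whence r divides v(G).

   Minimality of the subdivision is direct: a proper subgraph of it either
   contains at most one of the two new edges or is a subdivision of a proper
   subgraph of G. *)

Set Implicit Arguments.
Unset Strict Implicit.
Unset Printing Implicit Defensive.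

(** * Moving a defect between independent sets of a matroid *)

Record matroid_closure (E : finType) (cl : {set E} -> {set E}) : Prop :=
  MatroidClosure {
    closure_ext : forall X : {set E}, X \subset cl X;
    closure_mono : forall X Y : {set E}, X \subset Y -> cl X \subset cl Y;
    closure_idem : forall X : {set E}, cl (cl X) \subset cl X;
    closure_exchange : forall (X : {set E}) (e f : E),
      f \in cl (e |: X) -> f \notin cl X -> e \in cl (f |: X) }.

Section Matroid.

Variables (E : finType) (cl : {set E} -> {set E}).
Implicit Types (A F X Y : {set E}) (e f : E).

Hypothesis clM : matroid_closure cl.

Let cl_ext := closure_ext clM.
Let cl_mono := closure_mono clM.
Let cl_idem := closure_idem clM.
Let cl_exchange := closure_exchange clM.

Definition indep X := [forall f in X, f \notin cl (X :\ f)].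

Lemma cl_sub X Y : X \subset cl Y -> cl X \subset cl Y.
Proof. by move=> /cl_mono sXY; apply: subset_trans sXY (cl_idem Y). Qed.

Lemma cl_insert X e : e \in cl X -> cl (e |: X) = cl X.
Proof.
move=> eX; apply/eqP; rewrite eqEsubset [cl X \subset _]cl_mono ?subsetUr //.
by rewrite cl_sub // subUset sub1set eX cl_ext.
Qed.

Lemma indepS X Y : X \subset Y -> indep Y -> indep X.
Proof.
move=> sXY /forall_inP iY; apply/forall_inP => f fX.
by apply: contra (iY f (subsetP sXY f fX)); apply/subsetP/cl_mono/setSD.
Qed.

Lemma indepU1 X e : indep X -> e \notin cl X -> indep (e |: X).
Proof.
move=> /forall_inP iX eX; have eNX : e \notin X := contra (subsetP (cl_ext X) e) eX.
apply/forall_inP => f; rewrite in_setU1 => /orP[/eqP-> | fX]; first by rewrite setU1K.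
have neq_ef : e != f by apply: contraNneq eNX => ->.
have -> : (e |: X) :\ f = e |: X :\ f.
  by apply/setP=> g; rewrite !inE; case: (eqVneq g e) => // ->; rewrite neq_ef.
apply/negP => /cl_exchange /(_ (iX f fX)).
by rewrite setD1K // (negPf eX).
Qed.

(** Steinitz exchange: an element of [I] outside [J] is traded for one of [J], which keeps [I]
    independent and shrinks [I :\: J]. *)
Lemma indep_card_le I J : indep I -> I \subset cl J -> #|I| <= #|J|.
Proof.
have [n] := ubnP #|I :\: J|; elim: n I => // n IH I leIn iI sIJ.
have [|] := boolP (I \subset J); first exact: subset_leq_card.
case/subsetPn => x xI xJ.
have xNcl : x \notin cl (I :\ x) by move/forall_inP: iI => /(_ x xI).
have /subsetPn[y yJ yN] : ~~ (J \subset cl (I :\ x)).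
  by apply: contra xNcl => /cl_sub/subsetP; apply; apply: (subsetP sIJ).
have iI' : indep (y |: I :\ x) by apply: indepU1 => //; apply: indepS iI; apply: subD1set.
have yNI : y \notin I :\ x := contra (subsetP (cl_ext _) y) yN.
have -> : #|I| = #|y |: I :\ x| by rewrite cardsU1 yNI (cardsD1 x I) xI.
apply: IH => //.
  rewrite ltnS in leIn; apply: leq_trans leIn; apply: proper_card.
  apply/properP; split; last first.
    exists x; rewrite !inE ?xI ?xJ ?eqxx ?andbT ?orbF //=.
    by apply: contraNneq xJ => ->.
  apply/subsetP => g; rewrite !inE => /andP[gJ /predU1P[gy | /andP[_ ->]]].
    by rewrite gy yJ in gJ.
  by rewrite gJ.
rewrite subUset sub1set (subsetP (cl_ext J)) //=.
by apply: subset_trans sIJ; apply: subD1set.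
Qed.

(** For [F] independent and [e] in [cl F] but not in [F], this is the fundamental circuit of [e]
    with [e] itself removed. *)
Definition circuit F e := [set f in F | e \notin cl (F :\ f)].

(** A minimal [C] inside [F] spanning [e] lies in the circuit: if [F :\ f] spanned [e] for some [f]
    in [C], exchange in [C] would put [f] in [cl (F :\ f)]. *)
Lemma mem_cl_circuit F e : indep F -> e \in cl F -> e \in cl (circuit F e).
Proof.
move=> /forall_inP iF eF.
have [C /minsetP[eC minC] sCF] := minset_exists (P := fun X => e \in cl X) eF.
suff sC : C \subset circuit F e by apply: (subsetP (cl_mono sC)).
apply/subsetP => f fC; have fF := subsetP sCF f fC; rewrite inE fF /=.
apply: contra (iF f fF) => eFf.
have eNCf : e \notin cl (C :\ f).
  apply/negP => /minC /(_ (subD1set C f)) eq_C.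
  by move: fC; rewrite -eq_C setD11.
have fCe : f \in cl (e |: C :\ f) by apply: cl_exchange; rewrite ?setD1K.
rewrite -(cl_insert eFf); apply: subsetP fCe; apply/cl_mono/setUS/setSD/sCF.
Qed.

(** * Colourings, deficient families and moves of the defect *)

Variable r : nat.
Implicit Types (i a : 'I_r.+1) (Fs : {ffun 'I_r.+1 -> {set E}}).

(** In a graphic matroid this says that no cycle avoids a colour, i.e. every cycle uses all [r.+1]
    colours. *)
Definition colourable A :=
  [exists c : {ffun E -> 'I_r.+1}, [forall i, indep [set f in A | c f != i]]].

Definition misses (Fs : 'I_r.+1 -> {set E}) f := [set i | f \notin Fs i].

Lemma colourableI A (c : E -> 'I_r.+1) :
  (forall i, indep [set f in A | c f != i]) -> colourable A.
Proof.
move=> ic; apply/existsP; exists (finfun c); apply/forallP => i.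
by apply: indepS (ic i); apply/subsetP => f; rewrite !inE ffunE.
Qed.

Lemma colourable_family A (Fs : 'I_r.+1 -> {set E}) :
    (forall i, indep (Fs i)) -> {in A, forall f, #|misses Fs f| <= 1} ->
  colourable A.
Proof.
(* Each element is coloured by the index of the set missing it. The default [ord0] is harmless,
   since it is given only to elements lying in every set. *)
move=> iF mF; apply: (@colourableI _ (fun f => odflt ord0 [pick i in misses Fs f])) => i.
apply: indepS (iF i); apply/subsetP => f; rewrite inE => /andP[fA].
apply: contraR => fNi; case: pickP => [j | /(_ i)]; last by rewrite inE fNi.
move=> jm; have /card_le1_eqP/(_ i j) -> //= := mF f fA.
by rewrite inE.
Qed.

Variables (A : {set E}) (A_ncol : ~~ colourable A).

(* [Fs] almost witnesses [colourable A]: only [e] is left out of two of the sets. *)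
Definition deficient (Fs : 'I_r.+1 -> {set E}) e :=
  [/\ e \in A, forall i, Fs i \subset A, forall i, indep (Fs i) &
      {in A, forall f, #|misses Fs f| = (f == e).+1}].

Definition swap Fs a e f : {ffun 'I_r.+1 -> {set E}} :=
  [ffun i => if i == a then e |: Fs a :\ f else Fs i].

(** A state pairs a family with its defect. The defect [e] enters a set that misses it, and the
    element of its circuit that leaves becomes the new defect. *)
Definition step : rel ({ffun 'I_r.+1 -> {set E}} * E) :=
  [rel p q : {ffun _ -> {set E}} * E |
     [exists a, [&& p.2 \notin p.1 a, q.2 \in circuit (p.1 a) p.2
                          & q.1 == swap p.1 a p.2 q.2]]].

(** Otherwise [e] could join [Fs a]; every element would then be missed at most once, and [A] would
    be colourable. *)
Lemma deficient_cl Fs e a : deficient Fs e -> e \in cl (Fs a).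
Proof.
case=> eA sFA iF mF; have [|eNa] := boolP (e \in Fs a); first exact: (subsetP (cl_ext _)).
apply: contraNT A_ncol => eNcl.
apply: (@colourable_family _ (fun i => if i == a then e |: Fs a else Fs i)) => [i | f fA].
  by case: ifP => // _; apply: indepU1.
have := mF f fA; have [-> | neq_fe] := eqVneq f e => mf.
  rewrite -ltnS -mf; apply: proper_card; apply/properP; split.
    apply/subsetP => i; rewrite !inE; case: eqP => // _.
    by rewrite setU11.
  by exists a; rewrite !inE ?eqxx ?setU11.
rewrite -mf; apply/subset_leq_card/subsetP => i; rewrite !inE.
by case: eqP => // ->; rewrite in_setU1 negb_or => /andP[].
Qed.

(** Only two counts change: index [a] stops missing [e] and starts missing [f], so the double miss
    passes from [e] to [f]. *)
Lemma step_deficient Fs e Gs f :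
  deficient Fs e -> step (Fs, e) (Gs, f) -> deficient Gs f.
Proof.
move=> [eA sFA iF mF] /existsP[a /and3P[/= eNa]]; rewrite inE => /andP[fa eNcl] /eqP->.
have neq_fe : f != e by apply: contraNneq eNa => <-.
have fA : f \in A := subsetP (sFA a) f fa.
split=> // [i | i | g gA]; rewrite ?ffunE.
- case: eqP => // _; rewrite subUset sub1set eA.
  by apply: subset_trans (sFA a); apply: subD1set.
- by case: eqP => // _; apply: indepU1 => //; apply: indepS (iF a); apply: subD1set.
have := mF g gA; have [-> | neq_ge] := eqVneq g e.
  rewrite (negPf (_ : e != f)) 1?eq_sym // (cardsD1 a) inE eNa => -[<-].
  by apply: eq_card => i; rewrite !inE ffunE; case: eqP => //=; rewrite setU11.
have [-> mf | neq_gf <-] := eqVneq g f.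
  rewrite (cardsD1 a) inE ffunE eqxx !inE (negPf neq_fe) eqxx /= add1n.
  congr _.+1; rewrite -[in RHS]mf; apply: eq_card => i; rewrite !inE ffunE; case: eqP => [->|] //=.
  by rewrite fa.
apply: eq_card => i; rewrite !inE ffunE; case: eqP => // ->.
by rewrite !inE (negPf neq_ge) neq_gf.
Qed.

(** * The set of elements that the defect can reach *)

Variables (Fs0 : {ffun 'I_r.+1 -> {set E}}) (e0 : E).
Hypothesis def0 : deficient Fs0 e0.

Definition reach := [set f | [exists Fs, connect step (Fs0, e0) (Fs, f)]].

Lemma reachP f : reflect (exists Fs, connect step (Fs0, e0) (Fs, f)) (f \in reach).
Proof. by rewrite inE; apply: existsP. Qed.

Lemma mem_reach0 : e0 \in reach.
Proof. by apply/reachP; exists Fs0. Qed.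

Lemma circuit_reach Fs e a : connect step (Fs0, e0) (Fs, e) -> e \notin Fs a ->
  circuit (Fs a) e \subset reach.
Proof.
move=> cFe eNa; apply/subsetP => f fC; apply/reachP; exists (swap Fs a e f).
by apply: connect_trans cFe (connect1 _); apply/existsP; exists a; rewrite eNa fC eqxx.
Qed.

(* A step keeps the closure of each [Fs i :&: reach], because the whole circuit
   along which an element is swapped lies in [reach]. *)
Lemma connect_invariant Fs e : connect step (Fs0, e0) (Fs, e) ->
  deficient Fs e /\ forall i, cl (Fs i :&: reach) = cl (Fs0 i :&: reach).
Proof.
case/connectP => p; elim/last_ind: p Fs e => [|p [Gs f] IH] Fs e.
  by move=> _ [-> ->].
rewrite rcons_path last_rcons => /andP[pth st] [-> ->]; case lastE : (last _ p) st => [Hs g] st.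
have [def inv] := IH _ _ pth (esym lastE); have defG := step_deficient def st.
split=> // i; rewrite -inv.
have cg : connect step (Fs0, e0) (Hs, g) by apply/connectP; exists p; rewrite ?lastE.
have gR : g \in reach by apply/reachP; exists Hs.
have [_ _ iH _] := def.
move/existsP: st => [a /and3P[/= gNa fC /eqP->]]; rewrite ffunE; case: eqP => // ->.
have sCR := circuit_reach cg gNa; have fR := subsetP sCR f fC.
have gC := mem_cl_circuit (iH a) (deficient_cl a def).
have [fa gNf] : f \in Hs a /\ g \notin cl (Hs a :\ f) by move: fC; rewrite inE => /andP.
have sCHR : circuit (Hs a) g \subset Hs a :&: reach.
  by rewrite subsetI sCR andbT; apply/subsetP => h; rewrite inE => /andP[].
have gHR : g \in cl (Hs a :&: reach) := subsetP (cl_mono sCHR) g gC.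
have -> : (g |: Hs a :\ f) :&: reach = g |: (Hs a :&: reach) :\ f.
  apply/setP => h; rewrite !(in_setI, in_setU1, in_setD1).
  by case: (eqVneq h g) => [->|_] /=; rewrite ?gR // andbA.
(* The closures before and after the swap both equal that of [g |: (Hs a :&: reach)]: [g] is spanned
   before it, and [f] after it, by exchange. *)
have fcl : f \in cl (g |: (Hs a :&: reach) :\ f).
  apply: cl_exchange; last by apply: contra gNf; apply/subsetP/cl_mono/setSD/subsetIl.
  by rewrite setD1K // in_setI fa.
rewrite -(cl_insert fcl) setUCA setD1K ?(cl_insert gHR) //.
by rewrite in_setI fa.
Qed.

Lemma reach_sub : reach \subset A.
Proof. by apply/subsetP => f /reachP[Fs /connect_invariant[[]]]. Qed.

(** When the defect sits at [f], either [f] is in the current set [i] or its circuit there lies in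
    [reach]; the invariant carries this back to [Fs0]. *)
Lemma reach_cl i : reach \subset cl (Fs0 i :&: reach).
Proof.
apply/subsetP => f fR; have /reachP[Fs cf] := fR.
have [def inv] := connect_invariant cf; have [_ _ iF _] := def.
rewrite -inv; have [fi | fNi] := boolP (f \in Fs i).
  by apply: (subsetP (cl_ext _)); rewrite inE fi.
have := mem_cl_circuit (iF i) (deficient_cl i def); apply/subsetP/cl_mono.
rewrite subsetI (circuit_reach cf fNi) andbT.
by apply/subsetP => h; rewrite inE => /andP[].
Qed.

(** All the sets [Fs0 j :&: reach] are bases of [reach], hence of equal size; the incidences between
    [reach] and the sets are then counted twice. *)
Lemma reach_card i : r * #|reach| = (r.+1 * #|Fs0 i :&: reach|).+1.
Proof.
have [_ _ iF mF] := def0.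
have cardF j : #|Fs0 j :&: reach| = #|Fs0 i :&: reach|.
  apply/eqP; rewrite eqn_leq !indep_card_le //.
  - by apply: indepS (iF i); apply: subsetIl.
  - by apply: subset_trans (reach_cl j); apply: subsetIr.
  - by apply: indepS (iF j); apply: subsetIl.
  - by apply: subset_trans (reach_cl i); apply: subsetIr.
have -> : r.+1 * #|Fs0 i :&: reach| = \sum_(f in reach) #|[set j | f \in Fs0 j]|.
  rewrite -{1}(card_ord r.+1) -sum_nat_const -(eq_bigr _ (fun j _ => cardF j)).
  under eq_bigr do rewrite -sum1_card; under [RHS]eq_bigr do rewrite -sum1_card.
  rewrite (exchange_big_dep (mem reach)) /=; last by move=> j f _; rewrite inE => /andP[].
  by apply: eq_bigr => f fR; apply: eq_bigl => j; rewrite in_setI fR andbT in_set.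
(* Each element lies in [r] of the [r.+1] sets, except [e0], which lies in one fewer; this is the
   source of the successor in the conclusion. *)
have miss f : f \in reach -> #|[set j | f \in Fs0 j]| + (f == e0) = r.
  move=> fR; have := mF f (subsetP reach_sub f fR).
  have := cardsC [set j | f \in Fs0 j]; rewrite card_ord.
  have -> : ~: [set j | f \in Fs0 j] = misses Fs0 f by apply/setP => j; rewrite !inE.
  by move=> sumE missE; move: sumE; rewrite missE addnS => -[].
rewrite mulnC -sum_nat_const -(eq_bigr _ miss) big_split /=.
suff -> : \sum_(f in reach) (f == e0) = 1 by rewrite addn1.
rewrite (bigD1 e0) ?mem_reach0 //= eqxx big1 // => f /andP[_ /negPf-> //].
Qed.

(* If [reach] were colourable, [r * #|reach|] would be at most [r.+1] times its rank. *)
Lemma reach_not_colourable : ~~ colourable reach.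
Proof.
apply/existsP => -[c /forallP ic].
have : r * #|reach| <= r.+1 * #|Fs0 ord0 :&: reach|; last by rewrite (reach_card ord0) ltnn.
(* An element of [reach] is left out of exactly one summand, that of its own colour. *)
have -> : r * #|reach| = \sum_(i < r.+1) #|[set f in reach | c f != i]|.
  under eq_bigr do rewrite -sum1_card.
  rewrite (exchange_big_dep (mem reach)) /=; last by move=> i f _; rewrite inE => /andP[].
  rewrite mulnC -sum_nat_const; apply: eq_bigr => f fR.
  rewrite sum1_card; transitivity #|predC1 (c f)|; first by rewrite cardC1 card_ord.
  apply: eq_card => i; transitivity (f \in [set g in reach | c g != i]) => //.
  by rewrite in_set fR inE eq_sym.
rewrite -[X in _ <= X * _](card_ord r.+1) -sum_nat_const; apply: leq_sum => i _.
apply: indep_card_le => //; apply: subset_trans (reach_cl ord0).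
by apply/subsetP => f; rewrite inE => /andP[].
Qed.

End Matroid.

(** * Graphic matroids *)

Section GraphicMatroid.

Variable T : finType.
Implicit Types (X Y F : {set {set T}}) (e f : {set T}) (x y z u v w : T).

Lemma set2_inj x y u v : [set x; y] = [set u; v] ->
  x = u /\ y = v \/ x = v /\ y = u.
Proof.
move=> eq_s; have : x \in [set u; v] by rewrite -eq_s set21.
have : y \in [set u; v] by rewrite -eq_s set22.
have : u \in [set x; y] by rewrite eq_s set21.
have : v \in [set x; y] by rewrite eq_s set22.
rewrite !inE => /orP[]/eqP ? /orP[]/eqP ? /orP[]/eqP ? /orP[]/eqP ?; subst; auto.
Qed.

Definition edge_rel X : rel T := fun x y => [set x; y] \in X.
Arguments edge_rel X x y /.

(* Elements of [{set T}] that are not pairs are coloops, singletons are loops. *)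
Definition gcl X : {set {set T}} :=
  X :|: [set [set p.1; p.2] | p : T * T & connect (edge_rel X) p.1 p.2].

Lemma connect_edge_sym X : connect_sym (edge_rel X).
Proof. by apply: sym_connect_sym => x y /=; rewrite setUC. Qed.

Lemma gclP X f : reflect
  (f \in X \/ exists x y, f = [set x; y] /\ connect (edge_rel X) x y) (f \in gcl X).
Proof.
rewrite in_setU; apply: (iffP orP) => -[fX | ]; try by left.
  by case/imsetP => -[x y]; rewrite inE /= => cxy ->; right; exists x, y.
by case=> x [y [-> cxy]]; right; apply/imsetP; exists (x, y); rewrite ?inE.
Qed.

Lemma gcl2 X x y : ([set x; y] \in gcl X) = connect (edge_rel X) x y.
Proof.
apply/gclP/idP => [[xyX | [u [v [/set2_inj uv cuv]]]] | cxy]; first exact: connect1.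
  by case: uv => -[-> ->]; rewrite // connect_edge_sym.
by right; exists x, y.
Qed.

Lemma connect_edgeS X Y : X \subset Y ->
  subrel (connect (edge_rel X)) (connect (edge_rel Y)).
Proof.
by move=> sXY; apply: connect_sub => x y xy; apply/connect1/(subsetP sXY).
Qed.

Lemma gcl_ext X : X \subset gcl X.
Proof. exact: subsetUl. Qed.

Lemma gcl_mono X Y : X \subset Y -> gcl X \subset gcl Y.
Proof.
move=> sXY; apply/subsetP => f /gclP[fX | [x [y [-> cxy]]]].
  by apply/(subsetP (gcl_ext Y))/(subsetP sXY).
by rewrite gcl2; apply: connect_edgeS cxy.
Qed.

Lemma gcl_idem X : gcl (gcl X) \subset gcl X.
Proof.
apply/subsetP => f /gclP[//| [x [y [-> cxy]]]].
rewrite gcl2; apply: connect_sub cxy => u v /=.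
by rewrite gcl2.
Qed.

(** A walk can be shortened until it crosses [e] at most once: two crossings in the same direction
    merge into one, two opposite ones cancel. *)
Lemma connect_insert X e x y : connect (edge_rel (e |: X)) x y ->
  connect (edge_rel X) x y \/
  exists u v, [/\ e = [set u; v], connect (edge_rel X) x u & connect (edge_rel X) v y].
Proof.
case/connectP => p; elim: p x => [|w p IH] x /=.
  by move=> _ ->; left; apply: connect0.
case/andP=> xw pth lastp; have {IH pth lastp} := IH w pth lastp.
move: xw; rewrite in_setU1 => /orP[/eqP eq_e | xwX].
  case=> [cwy | [u [v [eE _ cvy]]]].
    by right; exists x, w; rewrite eq_e connect0.
  rewrite -eq_e in eE; case/set2_inj: eE => -[xE wE].
    by right; exists x, w; rewrite eq_e connect0 wE.
  by left; rewrite xE.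
have cxw : connect (edge_rel X) x w by apply: connect1.
case=> [cwy | [u [v [eE cwu cvy]]]]; first by left; apply: connect_trans cwy.
by right; exists u, v; split=> //; apply: connect_trans cwu.
Qed.

Lemma gcl_exchange X e f :
  f \in gcl (e |: X) -> f \notin gcl X -> e \in gcl (f |: X).
Proof.
move=> /gclP[|[x [y [-> cxy]]]].
  rewrite in_setU1 => /orP[/eqP-> _ | fX /negP[]]; first by apply/(subsetP (gcl_ext _))/setU11.
  exact: (subsetP (gcl_ext X)).
rewrite gcl2 => ncxy; case: (connect_insert cxy) => [|[u [v [-> cxu cvy]]]].
  by rewrite (negPf ncxy).
have up := connect_edgeS (subsetUr [set [set x; y]] X).
rewrite gcl2; apply: (connect_trans (y := x)); first by rewrite connect_edge_sym; apply: up.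
apply: (connect_trans (y := y)); first by apply/connect1/setU11.
by rewrite connect_edge_sym; apply: up.
Qed.

Lemma gcl_matroid : matroid_closure gcl.
Proof. exact: MatroidClosure gcl_ext gcl_mono gcl_idem gcl_exchange. Qed.

Notation gindep := (indep gcl).

Lemma gindepU1 X e : gindep X -> e \notin gcl X -> gindep (e |: X).
Proof. exact: (indepU1 gcl_matroid). Qed.

Lemma gindepS X Y : X \subset Y -> gindep Y -> gindep X.
Proof. exact: (indepS gcl_matroid). Qed.

Lemma connect_isolated X z w : (forall f, f \in X -> z \notin f) ->
  connect (edge_rel X) z w -> w = z.
Proof.
move=> zX /connectP[[|u p] //= /andP[zu _]].
by have := zX _ zu; rewrite set21.
Qed.

Lemma dependent_cycle X : (forall f, f \in X -> #|f| = 2) ->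
  ~~ gindep X -> exists s, 2 < size s /\ ucycle (edge_rel X) s.
Proof.
move=> X2; rewrite negb_forall => /existsP[f]; rewrite negb_imply negbK => /andP[fX].
case/gclP => [|[a [b [fE]]]]; first by rewrite setD11.
have neq_ab : a != b by have := X2 f fX; rewrite fE cards2; case: eqP.
case/connectP=> p0 /shortenP[p pth uniqp _] lastp {p0}.
exists (a :: p); rewrite /ucycle uniqp /= rcons_path -lastp andbT /=.
rewrite setUC -fE fX andbT.
case: p lastp pth {uniqp} => [/= lastp|u [|v p] lastp pth].
- by rewrite lastp eqxx in neq_ab.
- by move: pth; rewrite /= -[u]lastp -fE setD11.
by split=> //; apply: sub_path pth => c d /=; rewrite inE => /andP[].
Qed.

Lemma cycle_dependent X s : 2 < size s -> ucycle (edge_rel X) s -> ~~ gindep X.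
Proof.
case: s => [|a [|u q]] //= size_q /andP[cyc]; rewrite -[uniq _]/(uniq (a :: u :: q)).
move: cyc; rewrite /= rcons_path => /and3P[au pth ba] /and3P[].
rewrite inE negb_or => /andP[neq_au aq] uq _.
have neq_ub : u != last u q.
  by case: q size_q uq {pth ba aq} => // v q _ /= uq; apply: contraNneq uq => ->; apply: mem_last.
apply/negP => /forall_inP/(_ _ ba)/negP; apply; rewrite gcl2 connect_edge_sym.
set b := last u q in ba neq_ub *.
apply: (connect_trans (y := u)).
  apply: connect1; rewrite /= !inE au andbT; apply/eqP => /set2_inj[] [] h1 h2.
    by rewrite h2 eqxx in neq_au.
  by rewrite h2 eqxx in neq_ub.
apply/connectP; exists q => //.
apply: (sub_in_path (P := predC1 a)) pth => [c d ca da /= cd|].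
  rewrite !inE cd andbT; apply/eqP => cdE.
  have : a \in [set c; d] by rewrite cdE set22.
  by rewrite !inE !(eq_sym a) (negPf ca) (negPf da).
apply/allP => c; rewrite inE => /predU1P[-> | cq] /=; first by rewrite eq_sym.
by apply: contraNneq aq => <-.
Qed.

Lemma indep_insert_leaf F x z : (forall f, f \in F -> z \notin f) -> x != z ->
  gindep F -> gindep ([set x; z] |: F).
Proof.
move=> zF neq_xz iF; apply: gindepU1 => //; rewrite setUC gcl2.
by apply: contraNN neq_xz => /(connect_isolated zF) ->.
Qed.

Lemma indep_subdivide F x y z :
    (forall f, f \in F -> z \notin f) -> x != z -> y != z -> [set x; y] \notin F ->
  gindep ([set x; y] |: F) -> gindep ([set x; z] |: ([set z; y] |: F)).
Proof.
move=> zF neq_xz neq_yz xyF ixy.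
have iF : gindep F by apply: gindepS ixy; apply: subsetUr.
have nxy : [set x; y] \notin gcl F.
  by move/forall_inP: ixy => /(_ _ (setU11 _ _)); rewrite setU1K.
apply: gindepU1; first by rewrite [[set z; y]]setUC; apply: indep_insert_leaf.
rewrite gcl2; apply/negP => /connect_insert[|[u [v [eq_zy cxu cvz]]]].
  rewrite connect_edge_sym => /(connect_isolated zF) eq_xz.
  by rewrite eq_xz eqxx in neq_xz.
move: cvz; rewrite connect_edge_sym => /(connect_isolated zF) eq_vz.
case/set2_inj: eq_zy => -[eq1 eq2]; first by rewrite eq2 eq_vz eqxx in neq_yz.
by rewrite -eq2 -gcl2 (negPf nxy) in cxu.
Qed.

Lemma indep_unsubdivide F x y z :
    (forall f, f \in F -> z \notin f) -> x != z -> x != y ->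
  gindep ([set x; z] |: ([set z; y] |: F)) -> gindep ([set x; y] |: F).
Proof.
move=> zF neq_xz neq_xy iF.
apply: gindepU1; first by apply: gindepS iF; rewrite setUA subsetUr.
rewrite gcl2; move/forall_inP: iF => /(_ _ (setU11 _ _)).
rewrite setU1K.
  rewrite gcl2; apply: contra => cxy; apply: (connect_trans (y := y)).
    by apply: connect_edgeS cxy; apply: subsetUr.
  by apply: connect1; rewrite /= setUC setU11.
rewrite in_setU1 negb_or; apply/andP; split; last first.
  by apply: contraL (set22 x z); apply: zF.
apply/eqP => /set2_inj[[eq_xz _]|[eq_xy _]]; first by rewrite eq_xz eqxx in neq_xz.
by rewrite eq_xy eqxx in neq_xy.
Qed.

Lemma connect_split (U : {set T}) X Y a b :
    (forall f, f \in X -> f \subset U) -> (forall f, f \in Y -> f \subset ~: U) ->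
  connect (edge_rel (X :|: Y)) a b ->
  connect (edge_rel (if a \in U then X else Y)) a b.
Proof.
move=> XU YU /connectP[p]; elim: p a => [|w p IH] a /=; first by move=> _ ->.
case/andP=> aw pth lastp; have {IH pth lastp} := IH w pth lastp.
move: aw; rewrite in_setU => /orP[awX | awY].
  have /subsetP sU := XU _ awX.
  by rewrite !sU ?set21 ?set22 //; apply: connect_trans; apply: connect1.
have /subsetP sU := YU _ awY; have := sU a (set21 a w); have := sU w (set22 a w).
rewrite !inE => /negPf-> /negPf->; apply: connect_trans; exact: connect1.
Qed.

Lemma indep_split (U : {set T}) X Y :
    (forall f, f \in X -> f \subset U) -> (forall f, f \in Y -> f \subset ~: U) ->
  gindep X -> gindep Y -> gindep (X :|: Y).
Proof.
move=> XU YU /forall_inP iX /forall_inP iY; apply/forall_inP => f fXY.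
apply/negP => /gclP[|[a [b [fE]]]]; first by rewrite setD11.
rewrite setDUl => /(connect_split (U := U)) cab.
have {}cab : connect (edge_rel ((if a \in U then X else Y) :\ f)) a b.
  rewrite (fun_if (fun Z => Z :\ f)); apply: cab => g; rewrite inE => /andP[_].
    exact: XU.
  exact: YU.
move: fXY; rewrite in_setU => /orP[fX | fY].
  have aU : a \in U by apply: (subsetP (XU f fX)); rewrite fE set21.
  by move: cab; rewrite aU -gcl2 -fE; apply/negP/iX.
have : a \in ~: U by apply: (subsetP (YU f fY)); rewrite fE set21.
by rewrite inE => /negPf aU; move: cab; rewrite aU -gcl2 -fE; apply/negP/iY.
Qed.

Lemma card_spanning_forest (V : {set T}) X J x :
    x \in V -> {in V &, forall u v, connect (edge_rel X) u v} ->
    (forall f, f \in X -> f \subset V /\ #|f| = 2) ->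
    gindep J -> J \subset X -> X \subset gcl J -> #|V| = #|J|.+1.
Proof.
move=> xV conX XV iJ sJX sXJ.
pose star := [set [set x; u] | u in V :\ x].
have card_star : #|V| = #|star|.+1.
  rewrite (cardsD1 x V) xV card_in_imset // => u v; rewrite !inE => /andP[/negPf xu _] _.
  case/set2_inj => [[_ //] | [_ eq_ux]].
  by rewrite eq_ux eqxx in xu.
rewrite card_star; congr _.+1; apply/eqP; rewrite eqn_leq.
rewrite !(indep_card_le gcl_matroid) //.
- apply: subset_trans sJX _; apply/subsetP => f fX.
  have [fV /eqP/cards2P[a [b [_ fE]]]] := XV f fX.
  have cx w : w \in V -> connect (edge_rel star) x w.
    have [-> // | neq_wx wV] := eqVneq w x.
    by apply/connect1/imset_f; rewrite !inE neq_wx.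
  rewrite fE gcl2; apply: (connect_trans (y := x)).
    by rewrite connect_edge_sym cx // (subsetP fV) // fE set21.
  by rewrite cx // (subsetP fV) // fE set22.
- apply/forall_inP => g /imsetP[u]; rewrite in_setD1 => /andP[neq_ux uV] ->.
  rewrite setUC gcl2; apply: (contraNN _ neq_ux) => /connect_isolated -> // f.
  rewrite in_setD1 => /andP[neq_f /imsetP[v _ fE]]; rewrite fE in_set2 negb_or neq_ux /=.
  by apply: contra neq_f => /eqP->; rewrite fE setUC.
- apply/subsetP => g /imsetP[u]; rewrite in_setD1 => /andP[_ uV] ->.
  by apply: (subsetP (cl_sub gcl_matroid sXJ)); rewrite gcl2 conX.
Qed.

End GraphicMatroid.

Arguments edge_rel T X x y /.

(** * Cycle-Ramsey graphs *)

Section RamseyCycle.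

Variables (T : finType) (r : nat).
Implicit Types (G H : sgraph T) (X Y : {set {set T}}) (f : {set T}) (s : seq T).

Notation gindep := (indep (@gcl T)).
Notation gcolourable := (colourable (@gcl T) r).

Lemma edgeP G f : f \in eset G -> f \subset vset G /\ #|f| = 2.
Proof. by case: G => V E /= /forall_inP EV /EV /andP[-> /eqP->]. Qed.

Lemma cycle_edgesE X s : uniq s ->
  cycle (edge_rel X) s = (cycle_edges s \subset X).
Proof.
move=> uniq_s; apply/idP/subsetP => [cyc f /imsetP[x xs ->] | sX].
  exact: (next_cycle cyc xs).
by apply: cycle_from_next => // x xs; apply/sX/imset_f.
Qed.

Lemma ramseyP G : ramsey_cycle r G <-> ~~ gcolourable (eset G).
Proof.
split=> [ramG | ncolG c].
  apply/existsP => -[c /forallP ic]; have [s [[size_s /andP[cyc_s uniq_s]] leqr]] := ramG c.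
  have /subsetPn[i _ iNc] : ~~ ([set: 'I_r.+1] \subset c @: cycle_edges s).
    by apply/negP => /subset_leq_card; rewrite cardsT card_ord leqNgt ltnS leqr.
  have := ic i; apply/negP; apply: cycle_dependent size_s _.
  rewrite /ucycle uniq_s andbT cycle_edgesE //.
  have sG : cycle_edges s \subset eset G by rewrite -cycle_edgesE.
  apply/subsetP => f fs; rewrite inE (subsetP sG) //=.
  by apply: contraNneq iNc => <-; apply: imset_f.
have [i dep_i] : exists i, ~~ gindep [set f in eset G | c f != i].
  apply/existsP; apply: contraNT ncolG; rewrite negb_exists => /forallP ic.
  by apply: (colourableI (gcl_matroid T) (c := c)) => i; have := ic i; rewrite negbK.
have [|s [size_s /andP[cyc_s uniq_s]]] := dependent_cycle _ dep_i.
  by move=> f; rewrite inE => /andP[/edgeP[]].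
move: cyc_s; rewrite cycle_edgesE // => /subsetP sF; exists s; split.
  split=> //; rewrite /ucycle uniq_s andbT -[adj G]/(edge_rel (eset G)) cycle_edgesE //.
  by apply/subsetP => f /sF; rewrite inE => /andP[].
rewrite -ltnS -[X in _ < X](card_ord r.+1) -cardsT; apply/proper_card/properP.
split; first exact: subsetT.
exists i => //; apply/imsetP => -[f /sF]; rewrite inE => /andP[_ neq_i eq_i].
by rewrite eq_i eqxx in neq_i.
Qed.

Lemma colourableS X Y : X \subset Y -> gcolourable Y -> gcolourable X.
Proof.
move=> sXY /existsP[c /forallP ic]; apply: (colourableI (gcl_matroid T) (c := c)) => i.
apply: gindepS (ic i); apply/subsetP => f; rewrite !inE => /andP[fX ->].
by rewrite (subsetP sXY).
Qed.

Lemma minimal_proper_colourable G (V : {set T}) X : minimal_ramsey_cycle r G ->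
    V \subset vset G -> X \subset eset G -> (forall f, f \in X -> f \subset V) ->
    (V != vset G) || (X != eset G) -> gcolourable X.
Proof.
move=> [_ minG] sV sX XV neq.
have okH : [forall f in X, (f \subset V) && (#|f| == 2)].
  by apply/forall_inP => f fX; rewrite XV //; have [_ ->] := edgeP (subsetP sX f fX).
apply: contraT => /(ramseyP (SGraph okH)).2 /minG; case.
split=> [|eqG]; first by rewrite /subgraph sV.
by rewrite -eqG !eqxx in neq.
Qed.

Lemma minimal_connected G : minimal_ramsey_cycle r G ->
  {in vset G &, forall x y, connect (edge_rel (eset G)) x y}.
Proof.
move=> minG x y xG yG; apply: contraT => ncxy.
pose U := [set v | connect (edge_rel (eset G)) x v].
pose X := [set f in eset G | f \subset U]; pose Y := [set f in eset G | f \subset ~: U].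
have EXY f : f \in eset G -> (f \in X) || (f \in Y).
  move=> fG; have [_ /eqP/cards2P[a [b [_ fE]]]] := edgeP fG.
  rewrite !inE fG /= fE !subUset !sub1set !inE.
  have cab : connect (edge_rel (eset G)) a b by apply: connect1; rewrite /= -fE.
  by rewrite -(same_connect_r (@connect_edge_sym T _) cab) !andbb orbN.
have /existsP[c1 /forallP ic1] : gcolourable X.
  apply: (minimal_proper_colourable (V := vset G :&: U) minG).
  - exact: subsetIl.
  - by apply/subsetP => f; rewrite inE => /andP[].
  - by move=> f; rewrite inE subsetI => /andP[/edgeP[->]].
  - apply/orP; left; apply: contra ncxy => /eqP eqU.
    by move: yG; rewrite -eqU !inE => /andP[].
have /existsP[c2 /forallP ic2] : gcolourable Y.
  apply: (minimal_proper_colourable (V := vset G :&: ~: U) minG).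
  - exact: subsetIl.
  - by apply/subsetP => f; rewrite inE => /andP[].
  - by move=> f; rewrite inE subsetI => /andP[/edgeP[->]].
  - apply/orP; left; apply/eqP => eqU.
    by move: xG; rewrite -eqU !inE connect0 andbF.
case: minG => /ramseyP/negP[]; pose c f := if f \in X then c1 f else c2 f.
apply: (colourableI (gcl_matroid T) (c := c)) => i.
apply: gindepS (indep_split (U := U) _ _ (ic1 i) (ic2 i)) => [|f|f]; last 2 first.
- by rewrite in_set => /andP[]; rewrite in_set => /andP[].
- by rewrite in_set => /andP[]; rewrite in_set => /andP[].
apply/subsetP => f; rewrite in_set /c => /andP[/EXY].
rewrite in_setU [f \in [set g in X | _]]in_set [f \in [set g in Y | _]]in_set.
by case: (f \in X) => /= [_ -> // | -> ->].
Qed.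

Lemma subdivision_ramsey G Gp : minimal_ramsey_cycle r G ->
  ~~ (r %| order_graph G) -> edge_subdivision G Gp -> ramsey_cycle r Gp.
Proof.
move=> minG ndvd [x [y [z [xyG zG _ EGp]]]]; apply/ramseyP/negP => /existsP[c /forallP ic].
have ncolG : ~~ gcolourable (eset G) by apply/ramseyP; case: minG.
have [sxy /eqP] := edgeP xyG; rewrite cards2 eqSS eqb1 => neq_xy.
have [xG yG] : x \in vset G /\ y \in vset G by rewrite !(subsetP sxy) ?set21 ?set22.
have neq_xz : x != z by apply: contraNneq zG => <-.
set a := c [set x; z]; set b := c [set z; y].
pose base i := [set f in eset G :\ [set x; y] | c f != i].
pose Fs := [ffun i => if i \in [set a; b] then base i else [set x; y] |: base i].
have zbase i f : f \in base i -> z \notin f.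
  rewrite !inE => /andP[/andP[_ /edgeP[fG _]] _].
  by apply: contra zG; apply: (subsetP fG).
have sFG i : Fs i \subset eset G.
  have sB : base i \subset eset G by apply/subsetP => f; rewrite !inE => /andP[/andP[]].
  by rewrite ffunE; case: ifP => // _; rewrite subUset sub1set xyG.
have iF i : gindep (Fs i).
  rewrite ffunE; case: ifPn => [_ | ].
    apply: gindepS (ic i); rewrite EGp; apply/subsetP => f.
    by rewrite !inE => /andP[-> ->].
  rewrite in_set2 negb_or => /andP[ia ib]; apply: (indep_unsubdivide (z := z)) => //.
    exact: zbase.
  apply: gindepS (ic i); apply/subsetP => f; rewrite EGp in_set.
  rewrite 2!in_setU1 in_setU in_set2 => /or3P[/eqP-> | /eqP-> | ].
  - by rewrite eqxx orbT eq_sym.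
  - by rewrite eqxx !orbT eq_sym.
  - by rewrite in_set => /andP[-> ->].
have missF f : f \in eset G ->
    misses Fs f = if f == [set x; y] then [set a; b] else [set c f].
  move=> fG; apply/setP => i; rewrite in_set ffunE.
  have [-> | neq_f] := eqVneq f [set x; y].
    by case: (i \in [set a; b]); rewrite ?setU11 // !inE eqxx.
  transitivity (f \notin base i); last by rewrite !inE neq_f fG /= negbK eq_sym.
  by case: ifP => // _; rewrite in_setU1 (negPf neq_f).
have [eq_ab | neq_ab] := eqVneq a b.
  case/negP: ncolG; apply: (colourable_family (gcl_matroid T) iF) => f fG.
  by rewrite missF // eq_ab setUid; case: ifP => _; rewrite cards1.
have def : deficient (@gcl T) (eset G) Fs [set x; y].
  split=> // f fG; rewrite missF //; case: eqP => _; last by rewrite cards1.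
  by rewrite cards2 neq_ab.
have hyps := (@gcl_ext T, gcl_matroid T, @gcl_idem T, @gcl_exchange T).
pose R := reach (@gcl T) Fs [set x; y].
have RE : R = eset G.
  apply/eqP; apply: contraT => neq_RE.
  have /negP[] : ~~ gcolourable R := reach_not_colourable (gcl_matroid T) ncolG def.
  have sRG : R \subset eset G := reach_sub (gcl_matroid T) ncolG def.
  apply: (minimal_proper_colourable (V := vset G) minG) => //; last by rewrite neq_RE orbT.
  by move=> f /(subsetP sRG)/edgeP[].
have := reach_card (gcl_matroid T) ncolG def ord0; rewrite -/R RE (setIidPl (sFG _)).
have := reach_cl (gcl_matroid T) ncolG def ord0; rewrite -/R RE (setIidPl (sFG _)) => sGF.
have cardV := card_spanning_forest xG (minimal_connected minG) (@edgeP G) (iF _) (sFG _) sGF.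
move=> cardE; case/negP: ndvd; rewrite /order_graph cardV.
by rewrite -(dvdn_addr _ (dvdn_mulr #|Fs ord0| (dvdnn r))) addnS addnC -mulSn -cardE dvdn_mulr.
Qed.

Lemma subdivision_proper_colourable G Gp H : minimal_ramsey_cycle r G ->
  edge_subdivision G Gp -> proper_subgraph H Gp -> gcolourable (eset H).
Proof.
move=> minG [x [y [z [xyG zG VGp EGp]]]] [/andP[sVH sEH] neqH].
have [sxy /eqP] := edgeP xyG; rewrite cards2 eqSS eqb1 => neq_xy.
have [xG yG] : x \in vset G /\ y \in vset G by rewrite !(subsetP sxy) ?set21 ?set22.
have neq_xz : x != z by apply: contraNneq zG => <-.
have neq_yz : y != z by apply: contraNneq zG => <-.
have zE f : f \in eset G -> z \notin f.
  by case/edgeP=> /subsetP fG _; apply: contra zG; apply: fG.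
pose B := eset G :\ [set x; y].
have zB f : f \in B -> z \notin f by rewrite in_setD1 => /andP[_ /zE].
have leaf_colourable w : w != z -> eset H \subset [set w; z] |: B -> gcolourable (eset H).
  move=> neq_wz sHB; apply: colourableS sHB _.
  have /existsP[c /forallP ic] : gcolourable B.
    apply: (minimal_proper_colourable (V := vset G) minG) => //; first exact: subD1set.
      by move=> f; rewrite in_setD1 => /andP[_ /edgeP[]].
    by rewrite (proper_neq (properD1 xyG)) orbT.
  apply: (colourableI (gcl_matroid T) (c := c)) => i.
  apply: gindepS (indep_insert_leaf (F := [set f in B | c f != i]) _ neq_wz (ic i)).
    apply/subsetP => f; rewrite in_setU1 in_set in_setU1 => /andP[/predU1P[->|fB] ci].
      by rewrite eqxx.
    by rewrite in_set fB ci orbT.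
  by move=> f; rewrite in_set => /andP[/zB].
have sHB : eset H \subset [set x; z] |: ([set z; y] |: B).
  by rewrite setUA [_ :|: B]setUC -EGp.
have [xzH | xzNH] := boolP ([set x; z] \in eset H); last first.
  apply: (leaf_colourable y) => //; apply/subsetP => f fH.
  move: (subsetP sHB f fH); rewrite in_setU1 [[set y; z]]setUC => /predU1P[fE | //].
  by rewrite -fE fH in xzNH.
have [zyH | zyNH] := boolP ([set z; y] \in eset H); last first.
  apply: (leaf_colourable x) => //; apply/subsetP => f fH.
  move: (subsetP sHB f fH); rewrite !in_setU1 => /or3P[-> // | /eqP fE | ->]; last by rewrite orbT.
  by rewrite -fE fH in zyNH.
pose X := [set x; y] |: (eset H :&: B).
have sXG : X \subset eset G.
  by rewrite subUset sub1set xyG subIset // subD1set orbT.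
have XV f : f \in X -> f \subset vset G :&: vset H.
  rewrite in_setU1 in_setI in_setD1 subsetI.
  move=> /predU1P[-> | /and3P[/edgeP[-> _] _ /edgeP[-> _]] //].
  rewrite sxy subUset !sub1set /=; have [sxz _] := edgeP xzH; have [szy _] := edgeP zyH.
  by rewrite (subsetP sxz) ?set21 // (subsetP szy) ?set22.
have /existsP[c /forallP ic] : gcolourable X.
  apply: (minimal_proper_colourable minG (subsetIl _ _) sXG XV); rewrite -negb_and.
  apply/negP => /andP[/eqP eqV /eqP eqE]; case: neqH.
  have eqVH : vset H = vset Gp.
    apply/eqP; rewrite eqEsubset sVH VGp subUset sub1set -eqV subsetIr andbT.
    by have [/subsetP sxz _] := edgeP xzH; rewrite sxz ?set22.
  have eqEH : eset H = eset Gp.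
    apply/eqP; rewrite eqEsubset sEH EGp subUset /=; apply/andP; split; last first.
      by apply/subsetP => f; rewrite in_set2 => /orP[]/eqP->.
    apply/subsetP => f; rewrite in_setD1 -eqE in_setU1 => /andP[/negPf->] /=.
    by rewrite in_setI => /andP[].
  case: H Gp eqVH eqEH {sVH sEH VGp EGp leaf_colourable sHB xzH zyH X sXG XV eqV eqE}.
  move=> V E okH [V' E' okG] /= eqV eqE.
  by subst; congr SGraph; apply: bool_irrelevance.
pose c' f := if f \in [set [set x; z]; [set z; y]] then c [set x; y] else c f.
have zc f : f \in B -> c' f = c f.
  move=> /zB zf; rewrite /c' in_set2; case: eqP => [fE|_]; first by rewrite fE set22 in zf.
  by case: eqP => // fE; rewrite fE set21 in zf.
apply: (colourableI (gcl_matroid T) (c := c')) => i; pose F := [set f in eset H :&: B | c f != i].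
have zF f : f \in F -> z \notin f by rewrite in_set in_setI => /andP[/andP[_ /zB]].
have FH f : f \in eset H -> c' f != i ->
    [\/ f = [set x; z] /\ c [set x; y] != i, f = [set z; y] /\ c [set x; y] != i | f \in F].
  move=> fH; have := subsetP sHB f fH; rewrite !in_setU1 => /or3P[/eqP fE|/eqP fE|fB].
  - by rewrite /c' fE set21; constructor 1.
  - by rewrite /c' fE set22; constructor 2.
  - by rewrite zc // => ci; constructor 3; rewrite in_set in_setI fH fB.
have [ci | nci] := eqVneq (c [set x; y]) i.
  apply: gindepS (ic i); apply/subsetP => f; rewrite in_set => /andP[fH /(FH f fH)].
  rewrite ci eqxx => -[[] // | [] // | /setIdP[fHB cf]].
  by rewrite in_set in_setU1 fHB orbT cf.
apply: gindepS (indep_subdivide zF neq_xz neq_yz _ _).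
- apply/subsetP => f; rewrite in_set => /andP[fH /(FH f fH)]; rewrite !in_setU1.
  by case=> [[-> _] | [-> _] | ->]; rewrite ?eqxx ?orbT.
- by rewrite in_set in_setI setD11 andbF.
apply: gindepS (ic i); apply/subsetP => f; rewrite in_setU1 => /predU1P[-> | /setIdP[fHB cf]].
  by rewrite in_set setU11.
by rewrite in_set in_setU1 fHB orbT cf.
Qed.

End RamseyCycle.

Theorem theorem1p9 (T : finType) (r : nat) (G Gp : sgraph T) :
  2 <= r ->
  minimal_ramsey_cycle r G ->
  ~~ (r %| order_graph G) ->
  edge_subdivision G Gp ->
  minimal_ramsey_cycle r Gp.
Proof.
move=> _ minG ndvd subG; split=> [|H properH]; first exact: subdivision_ramsey subG.
by move/ramseyP/negP; apply; apply: subdivision_proper_colourable subG properH.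
Qed.
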